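(* Let $G$ be a triangle-free graph that contains no isolated vertex. Then (i) $\displaystyle a_1(G) = \min_{k \geq 0} \max\{k,\, n(G)-\alpha_k(G)\} = \min_{X\subseteq V(G)} \max\{\Delta(G-X),\, |X|\}$, where $k$ ranges over the non-negative integers; and (ii) $a_1'(G) = \Delta(G)$.
   Context: All graphs are finite, simple, and have at least one vertex. A clique of a graph $G$ is an inclusion-wise maximal complete subgraph (a vertex set of such a subgraph; an isolated vertex is a clique of size 1). The $(a,b)$-monochromatic clique transversal game ($(a,b)$-MCT game) on $G$ is played by Alice and Bob, who alternately take turns: in each of her turns Alice chooses $a$ unplayed vertices and colors them red, and in each of his turns Bob chooses $b$ unplayed vertices and colors them blue (if fewer unplayed vertices remain, the player colors all of them). Alice wins if the red vertices form a clique transversal, i.e. contain at least one vertex of each clique of $G$; Bob wins if all vertices of some clique of $G$ are blue. The game is Alice-start or Bob-start depending on who moves first. The threshold $a_1(G)$ (resp. $a_1'(G)$) is the smallest positive integer $a$ such that Alice has a winning strategy in the Alice-start (resp. Bob-start) $(a,1)$-MCT game on $G$. $n(G)$ is the number of vertices of $G$ and $\Delta(G)$ its maximum degree (with $\Delta = 0$ for the graph with no vertices, arising as $G-X$ with $X=V(G)$). For a non-negative integer $k$, $\alpha_k(G)$ is the $k$-independence number: the maximum cardinality of a set $S\subseteq V(G)$ such that the subgraph induced by $S$ has maximum degree at most $k$. $G-X$ is the graph obtained from $G$ by deleting the vertices of $X$. *)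

(* Defs.v *)
From mathcomp Require Import all_boot.

Set Implicit Arguments.
Unset Strict Implicit.
Unset Printing Implicit Defensive.

(* A simple graph is a symmetric irreflexive relation e on a finType T;
   an induced subgraph is identified with its vertex set. *)
Section Graph.
Variables (T : finType) (e : rel T).

Definition no_isolated := forall x, exists y, e x y.

Definition triangle_free := forall x y z, ~~ [&& e x y, e y z & e z x].

(* Maximum degree of the subgraph induced by S; 0 when S is empty. *)
Definition max_degree_in (S : {set T}) : nat :=
  \max_(x in S) #|[set y in S | e x y]|.

Definition max_degree : nat := max_degree_in [set: T].

Definition max_degree_del (X : {set T}) : nat := max_degree_in (~: X).

Definition k_independence (k : nat) : nat :=
  \max_(S : {set T} | max_degree_in S <= k) #|S|.

Definition complete (K : {set T}) : bool :=
  [forall x in K, forall y in K, (x != y) ==> e x y].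

Definition is_clique (K : {set T}) : bool := maxset complete K.

Definition clique_transversal (R : {set T}) : bool :=
  [forall (K : {set T} | is_clique K), R :&: K != set0].

End Graph.

Section Game.
Variables (T : finType) (e : rel T) (a b : nat).
Variable alice_start : bool.

(* A history lists the moves played so far, most recent first; a move is the
   set of vertices coloured in one turn. *)
Definition history := seq {set T}.

Definition alice_turn (h : history) : bool := alice_start (+) odd (size h).

Fixpoint red (h : history) : {set T} :=
  if h is m :: h' then
    if alice_turn h' then red h' :|: m else red h'
  else set0.

Fixpoint blue (h : history) : {set T} :=
  if h is m :: h' then
    if alice_turn h' then blue h' else blue h' :|: m
  else set0.

Definition unplayed (h : history) : {set T} := ~: (red h :|: blue h).

Definition legal_move (h : history) (m : {set T}) : bool :=
  [&& unplayed h != set0, m \subset unplayed h &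
      #|m| == minn (if alice_turn h then a else b) #|unplayed h|].

Fixpoint legal_play (h : history) : bool :=
  if h is m :: h' then legal_play h' && legal_move h' m else true.

Definition strategy := history -> {set T}.

(* Alice's moves in h are those prescribed by s; Bob's are arbitrary. *)
Fixpoint follows (s : strategy) (h : history) : bool :=
  if h is m :: h' then
    follows s h' && (alice_turn h' ==> (m == s h'))
  else true.

(* Plays are continued until every vertex is coloured.  This does not affect
   the winner: the red and blue sets only grow, and on a complete colouring the
   red set misses some clique iff that clique is entirely blue. *)
Definition alice_winning (s : strategy) : Prop :=
  (forall h, legal_play h -> follows s h ->
     alice_turn h -> unplayed h != set0 -> legal_move h (s h)) /\
  (forall h, legal_play h -> follows s h ->
     unplayed h = set0 -> clique_transversal e (red h)).

Definition alice_wins_game : Prop := exists s : strategy, alice_winning s.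

End Game.

(* m is the smallest positive a for which Alice wins the (a,1)-MCT game.  This
   is a relation because no such a need exist in general: in the Bob-start game
   Bob wins at once on an isolated vertex. *)
Definition is_threshold (T : finType) (e : rel T) (alice_start : bool)
    (m : nat) : Prop :=
  [/\ 0 < m, alice_wins_game e m 1 alice_start &
      forall a, 0 < a -> alice_wins_game e a 1 alice_start -> m <= a].

Definition is_a1 (T : finType) (e : rel T) (m : nat) : Prop :=
  is_threshold e true m.

Definition is_a1' (T : finType) (e : rel T) (m : nat) : Prop :=
  is_threshold e false m.

Definition is_minimum (I : Type) (f : I -> nat) (m : nat) : Prop :=
  (exists i, f i = m) /\ (forall i, m <= f i).

(* Main.v *)
Require Import Defs.
From mathcomp Require Import all_boot.

(** Since [G] is triangle-free without isolated vertices, its cliques are its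
    edges, so Alice wins exactly when the blue vertices end up independent.

    Alice, opening with [X], wins if she can always colour red every unplayed
    neighbour of a blue vertex: outside [X], each new blue vertex creates at
    most [Delta(G - X)] such obligations.  Conversely, if after her opening [X]
    some vertex has more than [a] unplayed neighbours, Bob takes it and then one
    of the neighbours that Alice could not cover.  The Bob-start game is the
    case of an empty opening. *)

(** A legal move has a prescribed size, so the vertices that Alice must colour have to be padded
    with other unplayed ones. *)
Lemma exists_subset_between (T : finType) (A B : {set T}) (k : nat) :
  A \subset B -> #|A| <= k <= #|B| ->
  exists C : {set T}, [/\ A \subset C, C \subset B & #|C| = k].
Proof.
elim: k => [|k IHk] sAB /andP[leA leB].
  by exists A; split=> //; apply/eqP; rewrite -leqn0.
have [eqA|neA] := eqVneq #|A| k.+1; first by exists A.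
have leAk : #|A| <= k by rewrite -ltnS ltn_neqAle neA.
have [C [sAC sCB cardC]] : exists C : {set T},
    [/\ A \subset C, C \subset B & #|C| = k].
  by apply: IHk => //; rewrite leAk ltnW.
have /set0Pn[x /setDP[xB xC]] : B :\: C != set0.
  by rewrite -card_gt0 cardsD (setIidPr sCB) cardC subn_gt0.
exists (x |: C); split; last by rewrite cardsU1 xC cardC.
  exact: subset_trans sAC (subsetUr _ _).
by rewrite subUset sub1set xB.
Qed.

(** * Degrees and [k]-independent sets *)

Section Degree.
Variables (T : finType) (e : rel T).

Lemma max_degree_inP (S : {set T}) (k : nat) :
  reflect (forall x, x \in S -> #|[set y in S | e x y]| <= k)
          (max_degree_in e S <= k).
Proof. exact: bigmax_leqP. Qed.

Lemma leq_k_independence (k : nat) (S : {set T}) :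
  max_degree_in e S <= k -> #|S| <= k_independence e k.
Proof. by move=> leS; apply: (bigmax_sup S). Qed.

Lemma k_independence_attained (k : nat) :
  exists2 S : {set T}, max_degree_in e S <= k & k_independence e k = #|S|.
Proof.
have deg0 : max_degree_in e set0 <= k.
  by apply/max_degree_inP => x; rewrite inE.
rewrite /k_independence.
have := @eq_bigmax_cond _ [pred S | max_degree_in e S <= k] (fun S => #|S|).
case; first by apply/card_gt0P; exists set0.
by move=> S leS eqS; exists S.
Qed.

Lemma max_degree_gt0 : 0 < #|T| -> no_isolated e -> 0 < max_degree e.
Proof.
move=> /card_gt0P[x _] e_ni; have [y exy] := e_ni x.
rewrite lt0n; apply/negP => /eqP deg0.
have /max_degree_inP/(_ x (in_setT x)) : max_degree_in e [set: T] <= 0.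
  by rewrite -/(max_degree e) deg0.
by rewrite leqn0 cards_eq0 => /eqP/setP/(_ y); rewrite !inE exy.
Qed.

End Degree.

(** Transfers a minimum between vertex sets and integers, which are not in bijection: domination in
    both directions is enough. *)
Lemma is_minimum_mutual (I J : Type) (f : I -> nat) (g : J -> nat) (m : nat) :
  (forall i, exists j, g j <= f i) -> (forall j, exists i, f i <= g j) ->
  is_minimum f m -> is_minimum g m.
Proof.
move=> gf fg [[i0 fi0] min_f]; have min_g j : m <= g j.
  by have [i] := fg j; apply: leq_trans.
split=> //; have [j] := gf i0; rewrite fi0 => gj.
by exists j; apply/eqP; rewrite eqn_leq gj min_g.
Qed.

(** Complements give the domination: [X] goes to [k = Delta(G - X)], for which [~: X] is
    [k]-independent, and [k] goes to the complement of a largest [k]-independent set. *)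
Lemma is_minimum_k_independence (T : finType) (e : rel T) (m : nat) :
  is_minimum (fun X : {set T} => maxn (max_degree_del e X) #|X|) m ->
  is_minimum (fun k => maxn k (#|T| - k_independence e k)) m.
Proof.
apply: is_minimum_mutual => [X|k].
  exists (max_degree_del e X); rewrite geq_max leq_maxl /=.
  apply: leq_trans (leq_maxr _ _); rewrite leq_subCl.
  by rewrite -[in X in X <= _](setCK X) -cardsCs leq_k_independence.
have [S leS ->] := k_independence_attained T e k.
exists (~: S); rewrite /max_degree_del setCK [#|~: S|]cardsCs setCK.
by rewrite geq_max leq_maxr andbT (leq_trans leS) ?leq_maxl.
Qed.

(** * Cliques and edges *)

Section Cliques.
Variables (T : finType) (e : rel T).
Hypotheses (e_sym : symmetric e) (e_irr : irreflexive e).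

Lemma complete_edge x y : e x y -> complete e [set x; y].
Proof.
move=> exy; apply/forall_inP => u /set2P uE; apply/forall_inP => v /set2P vE.
by apply/implyP; case: uE vE => -> [] ->; rewrite ?eqxx // e_sym.
Qed.

Lemma completeP (K : {set T}) :
  reflect {in K &, forall x y, x != y -> e x y} (complete e K).
Proof.
apply: (iffP forall_inP) => [cK x y xK yK /(implyP (forall_inP (cK x xK) y yK))|cK x xK] //.
by apply/forall_inP => y yK; apply/implyP/cK.
Qed.

(** A third vertex in a complete set containing [x] and [y] would close a triangle. *)
Lemma clique_edge x y : triangle_free e -> e x y -> is_clique e [set x; y].
Proof.
move=> e_tf exy; apply/maxsetP; split=> [|K /completeP cK sK].
  exact: complete_edge.
apply/eqP; rewrite eqEsubset sK andbT; apply/subsetP => z zK.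
have [xK yK] : x \in K /\ y \in K by rewrite !(subsetP sK) ?inE ?eqxx ?orbT.
rewrite !inE; apply/norP => -[zx zy].
have := e_tf x y z; rewrite exy cK 1?[y == z]eq_sym //.
by rewrite cK.
Qed.

Lemma clique_contains_edge (K : {set T}) :
  0 < #|T| -> no_isolated e -> is_clique e K ->
  exists x y, [/\ x \in K, y \in K & e x y].
Proof.
move=> /card_gt0P[x0 _] e_ni /maxsetP[/completeP cK maxK].
(* By maximality such a [K] equals the edge. This excludes an empty [K] first, then handles a
   singleton. *)
have edge_le x y : e x y -> K \subset [set x] -> x \in K /\ y \in K.
  move=> exy sK; rewrite -(maxK [set x; y]) ?complete_edge //.
    by rewrite !inE !eqxx orbT.
  by apply: subset_trans sK _; rewrite sub1set !inE eqxx.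
have [x xK] : exists x, x \in K.
  have [y exy] := e_ni x0.
  have [K0|/set0Pn //] := eqVneq K set0.
  by exists x0; have [|x0K _] := edge_le _ _ exy; first by rewrite K0 sub0set.
have [y exy] := e_ni x.
have [sK|/subsetPn[z zK]] := boolP (K \subset [set x]).
  by have [_ yK] := edge_le x y exy sK; exists x, y.
by rewrite inE eq_sym => xz; exists x, z; split=> //; apply: cK.
Qed.

Lemma clique_transversal_of_independent (R B : {set T}) :
  0 < #|T| -> no_isolated e -> R :|: B = setT ->
  {in B &, forall x y, ~~ e x y} -> clique_transversal e R.
Proof.
move=> T_gt0 e_ni RB indB; apply/forall_inP => K cK.
have [x [y [xK yK exy]]] := clique_contains_edge K T_gt0 e_ni cK.
apply/set0Pn; have inRB z : (z \in R) || (z \in B) by rewrite -in_setU RB inE.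
have [xR|xR] := boolP (x \in R); first by exists x; rewrite inE xR.
exists y; rewrite inE yK andbT; have := inRB y; have := inRB x.
rewrite (negbTE xR) /= => xB; case/orP => // yB.
by have := indB x y xB yB; rewrite exy.
Qed.

End Cliques.

(** * Histories and legal moves *)

Section Game.
Variables (T : finType) (e : rel T) (a : nat) (alice_start : bool).
Hypotheses (e_sym : symmetric e) (e_irr : irreflexive e).

Local Notation alice_turn := (alice_turn alice_start).
Local Notation red := (red alice_start).
Local Notation blue := (blue alice_start).
Local Notation unplayed := (@unplayed T alice_start).
Local Notation legal_move := (legal_move a 1 alice_start).
Local Notation legal_play := (legal_play a 1 alice_start).
Local Notation follows := (follows alice_start).
Implicit Types (h : history T) (m X : {set T}) (s : strategy T).

Lemma alice_turn_cons m h : alice_turn (m :: h) = ~~ alice_turn h.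
Proof. by rewrite /Defs.alice_turn /= addbN. Qed.

Lemma unplayed_cons m h : unplayed (m :: h) = unplayed h :\: m.
Proof.
by apply/setP => x; rewrite /Defs.unplayed /=; case: ifP => _; rewrite !inE;
   case: (x \in m); case: (x \in red h); case: (x \in blue h).
Qed.

Lemma unplayed_nil : unplayed [::] = setT.
Proof. by apply/setP => x; rewrite !inE. Qed.

Lemma red_blue_disjoint h : legal_play h -> [disjoint red h & blue h].
Proof.
elim: h => [|m h IHh] /=; first by rewrite disjoints_subset sub0set.
case/andP => /IHh dis /and3P[_ sub _]; move: sub; rewrite /Defs.unplayed setCU subsetI.
case/andP => sR sB; case: ifP => _.
  by rewrite -setI_eq0 setIUl setU_eq0 !setI_eq0 dis disjoints_subset.
by rewrite -setI_eq0 setIUr setU_eq0 !setI_eq0 dis disjoint_sym disjoints_subset.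
Qed.

Lemma legal_bob_move h v :
  ~~ alice_turn h -> v \in unplayed h -> legal_move h [set v].
Proof.
move=> /negbTE bob vU; have U_gt0 : 0 < #|unplayed h| by apply/card_gt0P; exists v.
by rewrite /Defs.legal_move bob sub1set vU cards1 (minn_idPl U_gt0) eqxx -card_gt0 U_gt0.
Qed.

(** * Alice's covering strategy *)

Section Alice.
Variable X : {set T}.

(* Besides the neighbours of blue vertices, Alice owes the vertices of her
   opening [X], so that the opening needs no separate treatment. *)
Definition obligations h : {set T} :=
  [set y in unplayed h | (y \in X) || [exists x in blue h, e x y]].

(** The default [set0] is never reached on a turn of Alice with vertices left and at most [a]
    obligations. *)
Definition cover_strategy : strategy T := fun h =>
  odflt set0 [pick m : {set T} | legal_move h m && (obligations h \subset m)].

Lemma cover_strategyP h :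
  alice_turn h -> unplayed h != set0 -> #|obligations h| <= a ->
  legal_move h (cover_strategy h) && (obligations h \subset cover_strategy h).
Proof.
move=> alice U0 leO; rewrite /cover_strategy; case: pickP => //= no_move.
have sOU : obligations h \subset unplayed h.
  by apply/subsetP => y; rewrite inE => /andP[].
have [|m [sOm smU cardm]] := exists_subset_between _ _ _ (minn a #|unplayed h|) sOU.
  by rewrite leq_min leO subset_leq_card //= geq_minr.
by have := no_move m; rewrite /Defs.legal_move alice U0 smU cardm eqxx sOm.
Qed.

(** Induction on the play. Initially the obligations are [X] itself, so [X] must be empty when Bob
    starts. Alice clears all obligations in one move, and Bob's next vertex creates at most
    [Delta(G - X)] new ones. *)
Lemma cover_strategy_invariant h :
  #|X| <= (if alice_start then a else 0) -> max_degree_del e X <= a ->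
  legal_play h -> follows cover_strategy h ->
  {in blue h &, forall x y, ~~ e x y} /\
  #|obligations h| <= (if alice_turn h then a else 0).
Proof.
move=> leX /max_degree_inP degX; elim: h => [|m h IHh].
  move=> _ _; split=> [x y|]; first by rewrite inE.
  rewrite /Defs.alice_turn addbF; apply: leq_trans leX; apply: subset_leq_card.
  apply/subsetP => y; rewrite inE => /andP[_ /orP[//|/existsP[x]]].
  by rewrite inE.
rewrite alice_turn_cons /= => /andP[leg mov] /andP[fol sm].
have [indB leO] := IHh leg fol.
have U0 : unplayed h != set0 by case/and3P: mov.
case: (boolP (alice_turn h)) leO sm mov => alice /= leO.
  move=> /eqP-> _; split=> //; rewrite leqn0 cards_eq0 -subset0.
  have /andP[_ /subsetP sO] := cover_strategyP h alice U0 leO.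
  apply/subsetP => y; rewrite inE unplayed_cons /= alice => /andP[/setDP[yU ynm] yO].
  by move: ynm; rewrite sO // inE yU.
move=> _ /and3P[_ smU]; rewrite (negbTE alice).
rewrite (minn_idPl _) ?card_gt0 // => /cards1P[v mv]; subst m.
move: leO; rewrite leqn0 cards_eq0 => /eqP O0.
(* With no obligation pending, Bob can only take a vertex outside [X] without blue neighbours. *)
have free y : y \in unplayed h -> (y \notin X) /\ {in blue h, forall x, ~~ e x y}.
  move=> yU; have := in_set0 y; rewrite -O0 inE yU /= => /norP[-> nex]; split=> // x xB.
  by apply: contra nex => exy; apply/existsP; exists x; rewrite xB.
have vU : v \in unplayed h by rewrite -sub1set.
have [vX vB] := free v vU; split.
  move=> x y /setUP[xB|/set1P->] /setUP[yB|/set1P->]; rewrite ?e_irr //.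
  - exact: indB.
  - exact: vB.
  - by rewrite e_sym vB.
(* Every new obligation is a neighbour of [v] outside [X]. *)
apply: leq_trans (degX v _); last by rewrite inE.
apply/subset_leq_card/subsetP => y; rewrite [in X in X -> _]inE unplayed_cons /= (negbTE alice).
case/andP => /setDP[yU _]; have [yX yB] := free y yU.
rewrite (negbTE yX) /= => /existsP[x /andP[/setUP[xB|/set1P->] exy]].
  by rewrite (negbTE (yB x xB)) in exy.
by rewrite !inE yX.
Qed.

Lemma alice_wins_of_cover :
  0 < #|T| -> no_isolated e ->
  #|X| <= (if alice_start then a else 0) -> max_degree_del e X <= a ->
  alice_wins_game e a 1 alice_start.
Proof.
move=> T_gt0 e_ni leX degX; exists cover_strategy; split=> h leg fol.
  move=> alice U0; have [_] := cover_strategy_invariant h leX degX leg fol.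
  by rewrite alice => /(cover_strategyP h alice U0)/andP[].
have [indB _] := cover_strategy_invariant h leX degX leg fol.
move=> U0; apply: clique_transversal_of_independent indB => //.
by rewrite -[LHS]setCK -/(unplayed h) U0 setC0.
Qed.

End Alice.

(** * Bob's threats against a winning strategy *)

Section Bob.
Hypotheses (a_gt0 : 0 < a) (e_tf : triangle_free e).
Variable s : strategy T.
Hypothesis s_win : alice_winning e a 1 alice_start s.

(** Winning is only tested on complete plays, so the play is extended legally until no vertex is
    left. Blue only grows, and there a blue edge would be a clique without red vertices. *)
Lemma winning_blue_independent h :
  legal_play h -> follows s h -> {in blue h &, forall x y, ~~ e x y}.
Proof.
have [n] := ubnP #|unplayed h|; elim: n h => // n IHn h lehn leg fol.
have [U0|U0] := eqVneq (unplayed h) set0.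
  move=> x y xB yB; apply/negP => exy.
  have /forall_inP/(_ _ (clique_edge _ _ e_sym x y e_tf exy)) := s_win.2 h leg fol U0.
  case/set0Pn => z /setIP[zR zxy].
  have /disjointFr/(_ zR) := red_blue_disjoint h leg.
  by case/set2P: zxy => ->; rewrite ?xB ?yB.
have [m mov sm] : exists2 m, legal_move h m & alice_turn h ==> (m == s h).
  have [alice|bob] := boolP (alice_turn h); first by exists (s h); rewrite ?eqxx ?s_win.1.
  by have /set0Pn[v vU] := U0; exists [set v]; rewrite ?legal_bob_move.
have sB : blue h \subset blue (m :: h) by rewrite /=; case: ifP; rewrite ?subsetUl.
move=> x y /(subsetP sB) xB /(subsetP sB) yB.
apply: (IHn (m :: h)) xB yB; rewrite /= ?leg ?fol //.
(* The extension terminates since each move colours at least one vertex, as [a] is positive. *)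
rewrite ltnS in lehn; apply: leq_trans lehn; rewrite unplayed_cons cardsD.
have /and3P[_ smU /eqP cardm] := mov.
rewrite (setIidPr smU) ltn_subrL cardm leq_min card_gt0 U0 andbT.
by case: ifP; rewrite ?a_gt0.
Qed.

(** Otherwise Bob takes [v], Alice's at most [a] vertices miss some unplayed neighbour [y] of [v],
    and taking [y] gives Bob a blue edge. *)
Lemma winning_degree h v :
  legal_play h -> follows s h -> ~~ alice_turn h -> v \in unplayed h ->
  #|[set y in unplayed h | e v y]| <= a.
Proof.
move=> leg fol bob vU; rewrite leqNgt; apply/negP => lt_a.
set N := [set y in _ | _] in lt_a.
set h1 := [set v] :: h.
have leg1 : legal_play h1 by rewrite /= leg legal_bob_move.
have fol1 : follows s h1 by rewrite /= fol (negbTE bob).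
have alice1 : alice_turn h1 by rewrite alice_turn_cons.
(* Since [v] is not its own neighbour, colouring it leaves all of [N] unplayed. *)
have sNU : N \subset unplayed h1.
  apply/subsetP => y; rewrite inE unplayed_cons => /andP[yU evy].
  by rewrite !inE -in_setU -in_setC yU andbT; apply: contraTneq evy => ->; rewrite e_irr.
have U1 : unplayed h1 != set0.
  rewrite -card_gt0; apply: leq_trans (subset_leq_card sNU).
  exact: leq_ltn_trans lt_a.
have mov1 := s_win.1 h1 leg1 fol1 alice1 U1.
set h2 := s h1 :: h1.
have leg2 : legal_play h2 by apply/andP.
have fol2 : follows s h2 by apply/andP; split=> //; rewrite eqxx implybT.
have bob2 : ~~ alice_turn h2 by rewrite alice_turn_cons alice1.
have /subsetPn[y yN ynm] : ~~ (N \subset s h1).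
  apply/negP => /subset_leq_card leN; have /and3P[_ _ /eqP cardm] := mov1.
  have := leq_trans lt_a leN; rewrite cardm alice1.
  by rewrite ltnNge geq_minl.
have yU : y \in unplayed h2 by rewrite unplayed_cons inE ynm (subsetP sNU).
have evy : e v y by move: yN; rewrite inE => /andP[].
have blueE : blue ([set y] :: h2) = blue h :|: [set v] :|: [set y].
  by rewrite /= alice1 (negbTE bob) (negbTE bob2).
have leg3 : legal_play ([set y] :: h2) by apply/andP; split=> //; exact: legal_bob_move.
have fol3 : follows s ([set y] :: h2) by apply/andP; split=> //; rewrite (negbTE bob2).
have := winning_blue_independent _ leg3 fol3 v y.
by rewrite blueE !inE !eqxx !orbT evy => /(_ isT isT).
Qed.

End Bob.

End Game.

(** * Lower bounds on [a] *)

Section Bounds.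
Variables (T : finType) (e : rel T) (a : nat).
Hypotheses (e_sym : symmetric e) (e_irr : irreflexive e) (T_gt0 : 0 < #|T|).
Hypotheses (e_tf : triangle_free e) (a_gt0 : 0 < a).

(** The witness is the opening of a winning strategy: afterwards the unplayed vertices induce
    [G - X], and it is Bob's turn. *)
Lemma alice_start_opening :
  alice_wins_game e a 1 true ->
  exists X : {set T}, maxn (max_degree_del e X) #|X| <= a.
Proof.
case=> s s_win; exists (s [::]).
have mov : legal_move a 1 true [::] (s [::]).
  by apply: s_win.1 => //; rewrite unplayed_nil -card_gt0 cardsT.
rewrite geq_max; apply/andP; split; last first.
  by case/and3P: mov => _ _ /eqP->; exact: geq_minl.
have UE : unplayed true [:: s [::]] = ~: s [::].
  by rewrite unplayed_cons unplayed_nil setTD.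
rewrite /max_degree_del -UE; apply/max_degree_inP => v vU.
apply: (winning_degree _ _ _ _ e_sym e_irr a_gt0 e_tf s s_win) => //=.
Qed.

Lemma bob_start_max_degree : alice_wins_game e a 1 false -> max_degree e <= a.
Proof.
case=> s s_win; rewrite /max_degree -(unplayed_nil T false).
apply/max_degree_inP => v vU.
exact: (winning_degree _ _ _ _ e_sym e_irr a_gt0 e_tf s s_win).
Qed.

End Bounds.

Theorem theorem2p1 (T : finType) (e : rel T)
    (e_sym : symmetric e) (e_irr : irreflexive e) (T_gt0 : 0 < #|T|)
    (e_tf : triangle_free e) (e_ni : no_isolated e) :
  (exists m : nat,
     [/\ is_a1 e m,
         is_minimum (fun k : nat => maxn k (#|T| - k_independence e k)) m &
         is_minimum (fun X : {set T} => maxn (max_degree_del e X) #|X|) m]) /\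
  is_a1' e (max_degree e).
Proof.
have deg0 : max_degree_del e set0 = max_degree e.
  by rewrite /max_degree_del setC0.
have deg_gt0 := max_degree_gt0 _ _ T_gt0 e_ni.
split; last first.
  split=> // [|a a_gt0]; last exact: bob_start_max_degree.
  by apply: (alice_wins_of_cover _ _ _ _ e_sym e_irr set0); rewrite ?cards0 ?deg0.
pose g X := maxn (max_degree_del e X) #|X|.
(* There are finitely many sets [X], so the minimum is attained; [set0] only shows that candidates
   exist. *)
case: (arg_minnP g (isT : xpredT set0)) => X _ minX.
have min_g : is_minimum g (g X) by split=> [|Y]; [exists X | exact: minX].
exists (g X); split=> //; last exact: is_minimum_k_independence.
split=> [||a a_gt0].
(* A threshold must be positive: a nonempty [X] has positive size, and for an empty one [Delta(G)]
   is positive. *)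
- have [X0|] := eqVneq X set0; first by rewrite X0 /g deg0 leq_max deg_gt0.
  by rewrite -card_gt0 leq_max orbC => ->.
- by apply: (alice_wins_of_cover _ _ _ _ e_sym e_irr X); rewrite ?leq_maxl ?leq_maxr.
- move=> /(alice_start_opening _ _ _ e_sym e_irr T_gt0 e_tf a_gt0)[Y].
  exact: leq_trans (minX Y isT).
Qed.
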